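(* Consider the set $P$ of all parameters $t\in(\frac12,1)$ for which the central point $\frac12$ has exactly two addresses. There are uncountably many parameters in $P$. The parameter $t=1/\beta\approx .5652$, where $\beta$ denotes the real root of $x^3-2x-2$, is the largest accumulation point of $P$. The largest isolated parameter of $P$ is $t\approx .5674$.
   Context: For $t\in(\frac12,1)$ put $f_0(x)=tx$ and $f_1(x)=tx+1-t$ on $[0,1]$. A 01-sequence $s=s_1s_2\dots$ is an address of $x\in[0,1]$ (for the parameter $t$) if $x=\lim_{k\to\infty}f_{s_1}\cdots f_{s_k}(0)=\frac{1-t}{t}\sum_{k=1}^\infty s_kt^k$. *)

(* Defs.v *)
From HB Require Import structures.
From mathcomp Require Import all_boot all_order all_algebra.
From mathcomp Require Import all_classical all_reals all_analysis.

Set Implicit Arguments.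
Unset Strict Implicit.
Unset Printing Implicit Defensive.

Import Order.TTheory GRing.Theory Num.Theory.
Import numFieldNormedType.Exports.

Local Open Scope classical_set_scope.
Local Open Scope ring_scope.

(* The digits 0 and 1 are the booleans [false] and [true]:
   [ifs_map t false] is f_0 and [ifs_map t true] is f_1. *)
Definition ifs_map (R : realType) (t : R) (b : bool) (x : R) : R :=
  if b then t * x + 1 - t else t * x.

(* A sequence s_1 s_2 ... is [s : nat -> bool] with [s k] standing for s_(k+1);
   [ifs_comp t s k x] is f_(s_1) (f_(s_2) (... (f_(s_k) x))). *)
Definition ifs_comp (R : realType) (t : R) (s : nat -> bool) (k : nat) (x : R)
  : R := foldr (ifs_map t) x (mkseq s k).

Definition is_address (R : realType) (t : R) (s : nat -> bool) (x : R) : Prop :=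
  ifs_comp t s k 0 @[k --> \oo] --> x.

Definition addresses (R : realType) (t x : R) : set (nat -> bool) :=
  [set s | is_address t s x].

Definition two_address_parameters (R : realType) : set R :=
  [set t | 1 / 2 < t < 1 /\ (addresses t (1 / 2) #= `I_2)%card].

Definition is_largest (R : realType) (A : set R) (x : R) : Prop :=
  A x /\ ubound A x.

(* Equality after rounding to four decimals: [a] is a four-digit decimal and [x]
   lies within half a unit of its last place. *)
Definition approx4 (R : realType) (x a : R) : Prop :=
  `|x - a| < 1 / 2 / 10 ^+ 4.

(* Main.v *)
Require Import Defs.
From HB Require Import structures.
From mathcomp Require Import all_boot all_order all_algebra.
From mathcomp Require Import all_classical all_reals all_analysis.
From mathcomp Require Import ring lra.

(* Write q = 1/t. A central address starting with 0 is the only one iff the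
   orbit of 1 under w |-> |q w - 1| stays above gap q. For q below the root
   beta of x^3 - 2 x - 2 the fourth point of the orbit is above the fixed point
   1/(q + 1); the orbit is pushed away from it by the factor -q, and once it
   has left it can only survive by following the repelling 2-cycle exactly.
   Hence q solves one of the equations q^(2n) (2 + 2 q - q^3) (1 + q^2) = 2;
   the one with n = 2 gives the largest parameter, and solutions with q <= beta
   cluster only at beta, where the factor 2 + 2 q - q^3 vanishes.
   Uncountably many parameters come from addresses 0 1^6 x_0 (1 - x_0) x_1 (1 -
   x_1) ..., realised near t = 1/2 by the intermediate value theorem. *)

Set Implicit Arguments.
Unset Strict Implicit.
Unset Printing Implicit Defensive.

Import Order.TTheory GRing.Theory Num.Theory.
Import numFieldNormedType.Exports.

Local Open Scope classical_set_scope.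
Local Open Scope ring_scope.

(** * Values of addresses under the two contractions *)

Section AddressValue.
Variable R : realType.
Implicit Types (t x y : R) (s : nat -> bool).

Lemma ifs_compS t s k x :
  ifs_comp t s k.+1 x = ifs_map t (s 0%N) (ifs_comp t (s \o S) k x).
Proof. by rewrite /ifs_comp /mkseq /= (iotaDl 1 0 k) -map_comp. Qed.

Lemma ifs_compSr t s k x :
  ifs_comp t s k.+1 x = ifs_comp t s k (ifs_map t (s k) x).
Proof. by rewrite /ifs_comp mkseqS foldr_rcons. Qed.

Lemma ifs_mapE t b x : ifs_map t b x = t * x + b%:R * (1 - t).
Proof. by case: b; rewrite /ifs_map /=; ring. Qed.

Lemma ifs_mapB t b x y : ifs_map t b x - ifs_map t b y = t * (x - y).
Proof. by rewrite !ifs_mapE; ring. Qed.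

Lemma ifs_compB t s k x y :
  ifs_comp t s k x - ifs_comp t s k y = t ^+ k * (x - y).
Proof.
elim: k s => [|k IH] s; first by rewrite /ifs_comp /= mul1r.
by rewrite !ifs_compS ifs_mapB IH mulrA exprS.
Qed.

Lemma ifs_map_itv t b x : 0 < t < 1 -> 0 <= x <= 1 -> 0 <= ifs_map t b x <= 1.
Proof. by move=> /andP[? ?] /andP[? ?]; case: b; rewrite /ifs_map; nra. Qed.

Lemma ifs_comp_itv t s k x :
  0 < t < 1 -> 0 <= x <= 1 -> 0 <= ifs_comp t s k x <= 1.
Proof.
move=> t01; elim: k s => [//|k IH] s x01.
by rewrite ifs_compS; apply: ifs_map_itv => //; exact: IH.
Qed.

Let zero_itv : 0 <= (0 : R) <= 1. Proof. by rewrite lexx ler01. Qed.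

Definition address_value t s : R := lim (ifs_comp t s k 0 @[k --> \oo]).

Lemma is_address_value t s : 0 < t < 1 -> is_address t s (address_value t s).
Proof.
move=> t01; have /andP[t0 t1] := t01; apply: nondecreasing_is_cvgn.
  apply/nondecreasing_seqP => k; rewrite ifs_compSr -subr_ge0 ifs_compB subr0.
  rewrite mulr_ge0 ?exprn_ge0 ?(ltW t0)//.
  by have /andP[] := ifs_map_itv (s k) t01 zero_itv.
exists 1 => _ [k _ <-].
by have /andP[] := ifs_comp_itv s k t01 zero_itv.
Qed.

Lemma is_addressE t s x : 0 < t < 1 ->
  is_address t s x <-> address_value t s = x.
Proof.
move=> t01; split => [sx|<-]; last exact: is_address_value.
exact: (cvg_lim _ sx).
Qed.

Lemma address_value_itv t s : 0 < t < 1 -> 0 <= address_value t s <= 1.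
Proof.
move=> t01; have cv := is_address_value (s := s) t01.
have itv k := ifs_comp_itv s k t01 zero_itv.
apply/andP; split; [apply: limr_ge|apply: limr_le].
- by apply/cvg_ex; exists (address_value t s).
- by apply: nearW => k; case/andP: (itv k).
- by apply/cvg_ex; exists (address_value t s).
- by apply: nearW => k; case/andP: (itv k).
Qed.

(** After [k] digits the error is [t ^+ k * X k], which tends to 0 because the orbit stays in
    [0, 1]. This turns digit-by-digit constructions into addresses. *)
Lemma coded_orbit_address t s (X : nat -> R) : 0 < t < 1 ->
  (forall n, 0 <= X n <= 1) -> (forall n, X n = ifs_map t (s n) (X n.+1)) ->
  address_value t s = X 0%N.
Proof.
move=> t01 X01 XS; have /andP[t0 t1] := t01; apply/is_addressE => //.
have XE k : X 0%N = ifs_comp t s k (X k).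
  by elim: k => [//|k IH]; rewrite ifs_compSr -XS.
apply/cvgrPdist_le => e e0.
have t_cvg : t ^+ k @[k --> \oo] --> 0.
  by apply: cvg_expr; rewrite ger0_norm ?ltW.
have /cvgrPdist_le/(_ e e0) := t_cvg; apply: filterS => k.
rewrite sub0r normrN (XE k) ifs_compB subr0 normrM.
have /andP[Xk0 Xk1] := X01 k; rewrite (ger0_norm Xk0); apply: le_trans.
by rewrite ler_piMr.
Qed.

Lemma address_valueE t s : 0 < t < 1 ->
  address_value t s = ifs_map t (s 0%N) (address_value t (s \o S)).
Proof.
move=> t01; apply/is_addressE => //; have /andP[t0 t1] := t01.
rewrite /is_address -cvg_shiftS /=.
rewrite (_ : (fun k => _) = fun k =>
    t * ifs_comp t (s \o S) k 0 + (s 0%N)%:R * (1 - t)); last first.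
  by apply/funext => k; rewrite ifs_compS ifs_mapE.
have cv := is_address_value (s := s \o S) t01.
by rewrite ifs_mapE; apply: cvgD; [exact: cvgMl_tmp|exact: cvg_cst].
Qed.

Definition tail s n : nat -> bool := fun k => s (n + k)%N.

Lemma tail0 s : tail s 0 = s. Proof. by apply/funext => k. Qed.

Lemma tailS s n : tail s n \o S = tail s n.+1.
Proof. by apply/funext => k; rewrite /tail /= addnS. Qed.

Lemma address_value_tail t s n : 0 < t < 1 ->
  address_value t (tail s n) = ifs_map t (s n) (address_value t (tail s n.+1)).
Proof. by move=> t01; rewrite address_valueE // tailS /tail addn0. Qed.

Lemma address_value_compl t s : 0 < t < 1 ->
  address_value t (negb \o s) = 1 - address_value t s.
Proof.
move=> t01.
pose X n := 1 - address_value t (tail s n).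
rewrite (@coded_orbit_address t _ X) /X ?tail0 //.
  by move=> n; have /andP[? ?] := address_value_itv (tail s n) t01; lra.
move=> n; rewrite (address_value_tail _ _ t01) /=.
by case: (s n); rewrite /ifs_map /=; ring.
Qed.

(** The orbit takes digit 1 exactly above [t]; since 1 - t <= t, the chosen inverse branch keeps it
    in [0, 1]. *)
Lemma address_exists t x : 1 / 2 <= t < 1 -> 0 <= x <= 1 ->
  exists s, address_value t s = x.
Proof.
move=> /andP[t2 t1] x01; have t0 : 0 < t by lra.
pose g y := if t < y then (y - (1 - t)) / t else y / t.
pose X n := iter n g x.
exists (fun n => t < X n); apply: (@coded_orbit_address _ _ X).
- by rewrite t0.
- elim=> [//|n]; rewrite /X iterS -/(X n) /g => /andP[X0 X1].
  case: (ltP t (X n)) => tX.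
    by rewrite divr_ge0 ?ler_pdivrMr //=; lra.
  by rewrite divr_ge0 ?ler_pdivrMr //=; lra.
- move=> n; rewrite {3}/X iterS -/(X n) /g /ifs_map.
  by case: (ltP t (X n)) => tX; field; rewrite gt_eqF.
Qed.

End AddressValue.

(** * Uniqueness of central addresses and the orbit of 1 *)

Section CentralPoint.
Variable R : realType.
Implicit Types (t q : R) (s u : nat -> bool).

(** The images of [0, 1] under the two maps are [0, t] and [1 - t, 1]. A point outside their overlap
    lies in only one of them, so its digit is forced, and injectivity passes the equality of values
    on to the next tail. *)
Lemma unique_address t s u : 0 < t < 1 ->
  (forall n, if s n then t < address_value t (tail s n)
             else address_value t (tail s n) < 1 - t) ->
  address_value t u = address_value t s -> u = s.
Proof.
move=> t01 s_out us; have /andP[t0 t1] := t01.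
have digit n : address_value t (tail u n) = address_value t (tail s n) ->
    u n = s n.
  move=> e; have := s_out n; rewrite -e (address_value_tail _ _ t01).
  have /andP[? ?] := address_value_itv (tail u n.+1) t01.
  by case: (s n); case: (u n) => //; rewrite /ifs_map; nra.
have e n : address_value t (tail u n) = address_value t (tail s n).
  elim: n => [|n IH]; first by rewrite !tail0.
  have := IH; rewrite !(address_value_tail _ n t01) (digit _ IH) => /eqP.
  by rewrite -subr_eq0 ifs_mapB mulf_eq0 (gt_eqF t0) subr_eq0 => /eqP.
by apply/funext => n; exact: digit.
Qed.

(** Meant for the value 1/2, which lies in the overlap: its first digit is prescribed and the
    forcing starts at the first tail. *)
Lemma unique_central_address t s : 0 < t < 1 -> s 0%N = false ->
  (forall n, if s n.+1 then t < address_value t (tail s n.+1)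
             else address_value t (tail s n.+1) < 1 - t) ->
  forall u, address_value t u = address_value t s -> u 0%N = false -> u = s.
Proof.
move=> t01 s0 s_out u us u0; have /andP[t0 _] := t01.
suff us1 : tail u 1 = tail s 1.
  by apply/funext => -[|n]; [rewrite u0 s0|have /(congr1 (@^~ n)) := us1].
apply: (@unique_address t) => //.
move: us; rewrite -[u]tail0 -[s]tail0 !(address_value_tail _ 0 t01) !tail0.
rewrite u0 s0.
by rewrite /ifs_map; apply: mulfI; rewrite gt_eqF.
Qed.

(** Complementing digits reflects [0, 1] in 1/2, so it pairs the central addresses starting with 0
    with those starting with 1. *)
Lemma two_address_parametersP t : 1 / 2 < t < 1 ->
  two_address_parameters t <->
  exists s, [/\ address_value t s = 1 / 2, s 0%N = false &
    forall u, address_value t u = 1 / 2 -> u 0%N = false -> u = s].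
Proof.
move=> /andP[th t1]; have t01 : 0 < t < 1 by apply/andP; split; lra.
have compl s : address_value t s = 1 / 2 -> address_value t (negb \o s) = 1 / 2.
  by move=> e; rewrite address_value_compl // e; lra.
split=> [[_ /card_set_bijP[f [f2 finj _]]]|[s [sc s0 s_uniq]]]; last first.
  split; first by rewrite th.
  apply/card_set_bijP; exists (fun u : nat -> bool => u 0%N : nat); split.
  - by move=> u _ /=; case: (u 0%N).
  - have u_uniq u : is_address t u (1 / 2) ->
        u = if u 0%N then negb \o s else s.
      move/(is_addressE _ _ t01) => uc.
      case: ifPn => u0; last exact/s_uniq/negbTE.
      rewrite -(s_uniq (negb \o u)) /= ?u0 //; last exact: compl.
      by apply/funext => n /=; rewrite negbK.
    move=> u v /set_mem/u_uniq -> /set_mem/u_uniq ->.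
    by case: (u 0%N); case: (v 0%N); rewrite /= ?s0.
  - move=> [|[|//]] _; [exists s|exists (negb \o s)] => //=; rewrite ?s0 //.
    + exact/is_addressE.
    + exact/is_addressE/compl.
have [v vc] : exists v, address_value t v = 1 / 2.
  by apply: address_exists; apply/andP; split; lra.
have [s [sc s0]] : exists s, address_value t s = 1 / 2 /\ s 0%N = false.
  case v0 : (v 0%N); last by exists v.
  by exists (negb \o v); split; [exact: compl|rewrite /= v0].
exists s; split => // u uc u0.
have cs : address_value t (negb \o s) = 1 / 2 by exact: compl.
have inA w : address_value t w = 1 / 2 -> w \in addresses t (1 / 2).
  by move=> wc; apply/mem_set/is_addressE.
(* [u], [s] and the complement of [s] have only two possible images under the injective [f]; as the
   complement starts with 1, the coincidence must be [u = s]. *)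
have us : f u = f s -> u = s by apply: finj; exact: inA.
have := finj _ _ (inA _ uc) (inA _ cs); have := finj _ _ (inA _ sc) (inA _ cs).
have := f2 _ (set_mem (inA _ uc)); have := f2 _ (set_mem (inA _ sc)).
have := f2 _ (set_mem (inA _ cs)); rewrite /=; move: us.
case: (f u) => [|[|//]]; case: (f s) => [|[|//]]; case: (f _) => [|[|//]] //=;
  try (by move=> ->); move=> _ _ _ _.
all: try by move=> /(_ erefl)/(congr1 (@^~ 0%N)); rewrite /= s0.
all: by move=> _ /(_ erefl)/(congr1 (@^~ 0%N)); rewrite /= s0 u0.
Qed.

(* If [V n] is the point whose address is the n-th tail of a central address
   starting with 0 and [q = t^-1], then [`|2 * V n.+1 - 1| = (q - 1) * orb q n];
   [V n.+1] lies in the overlap [1 - t, t] iff [orb q n <= gap q]. *)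
Definition gap q : R := (2 - q) / (q * (q - 1)).

Definition orb q n : R := iter n (fun w => `|q * w - 1|) 1.

Lemma orbS q n : orb q n.+1 = `|q * orb q n - 1|. Proof. by []. Qed.

Lemma gap_inv t : 1 / 2 < t < 1 -> (t^-1 - 1) * gap t^-1 = 2 * t - 1.
Proof.
move=> /andP[? ?]; have t1 : t^-1 - 1 = (1 - t) / t by field; lra.
by rewrite /gap t1; field; apply/andP; split; lra.
Qed.

(** With y = 2 V - 1 and q = 1/t, the inverse maps are y |-> q y + (q - 1) for digit 0 and y |-> q y
    - (q - 1) for digit 1. Outside the overlap the digit is given by the sign of y, so |y| moves to
    |q |y| - (q - 1)|. *)
Lemma orb_address t s N : 1 / 2 < t < 1 -> address_value t s = 1 / 2 ->
  s 0%N = false -> (forall n, (n < N)%N -> gap t^-1 < orb t^-1 n) ->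
  `|2 * address_value t (tail s N.+1) - 1| = (t^-1 - 1) * orb t^-1 N.
Proof.
move=> t21 sc s0; have /andP[? ?] := t21.
have t01 : 0 < t < 1 by apply/andP; split; lra.
have q1 : 1 < t^-1 by rewrite invf_gt1; lra.
elim: N => [_|N IH gapN].
  move: sc; rewrite -{1}[s]tail0 (address_value_tail _ _ t01) s0 /ifs_map => e.
  have -> : address_value t (tail s 1) = t^-1 / 2.
    by apply: (mulfI (lt0r_neq0 (_ : 0 < t))); [lra|rewrite e; field; lra].
  by rewrite /orb /= ger0_norm; lra.
have lt_gap : 2 * t - 1 < (t^-1 - 1) * orb t^-1 N.
  by rewrite -gap_inv // ltr_pM2l ?subr_gt0 // gapN.
have := IH (fun n nN => gapN n (ltnW nN)).
rewrite orbS; set w := orb t^-1 N in lt_gap *.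
have /andP[] := address_value_itv (tail s N.+2) t01.
rewrite (address_value_tail _ N.+1 t01); set V := address_value t _ => V0 V1.
have q1' : `|t^-1 - 1| = t^-1 - 1 by rewrite gtr0_norm ?subr_gt0.
rewrite -q1' -normrM q1'.
have tV : t^-1 * t = 1 by rewrite mulVf //; lra.
case: (s N.+1); rewrite /ifs_map => e.
  have eV : 2 * (t * V + 1 - t) - 1 = (t^-1 - 1) * w.
    rewrite -e ger0_norm //; rewrite real_normrEsign ?num_real // in e.
    by move: e; case: ltP => //=; rewrite ?expr1 ?expr0 ?mulN1r; nra.
  congr `| _ |; have -> : (t^-1 - 1) * (t^-1 * w - 1) =
    t^-1 * ((t^-1 - 1) * w) - (t^-1 - 1) by ring.
  by rewrite -eV; field; lra.
have eV : 2 * (t * V) - 1 = - ((t^-1 - 1) * w).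
  rewrite -e ler0_norm ?opprK //; rewrite real_normrEsign ?num_real // in e.
  by move: e; case: ltP => //=; rewrite ?expr1 ?expr0 ?mulN1r; nra.
rewrite -normrN; congr `| _ |; have -> : (t^-1 - 1) * (t^-1 * w - 1) =
  - (t^-1 * - ((t^-1 - 1) * w)) - (t^-1 - 1) by ring.
by rewrite -eV; field; lra.
Qed.

(** While the orbit stays above [gap], every digit after the first is forced. At the first failure
    the point lies in the overlap, and the other digit continues to a second address starting with
    0. *)
Lemma two_address_parameters_orb t : 1 / 2 < t < 1 ->
  two_address_parameters t <-> forall n, gap t^-1 < orb t^-1 n.
Proof.
move=> t21; rewrite (two_address_parametersP t21); have /andP[? ?] := t21.
have t01 : 0 < t < 1 by apply/andP; split; lra.
have q1 : 0 < t^-1 - 1 by rewrite subr_gt0 invf_gt1; lra.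
split=> [[s [sc s0 s_uniq]] N|gap_orb]; last first.
  have [z zc] : exists z, address_value t z = t^-1 / 2.
    apply: address_exists; first by apply/andP; split; lra.
    have tV : t^-1 * t = 1 by rewrite mulVf //; lra.
    by apply/andP; split; nra.
  pose s n := if n is k.+1 then z k else false.
  have sz : tail s 1 = z by apply/funext.
  have sc : address_value t s = 1 / 2.
    rewrite -[s]tail0 (address_value_tail _ _ t01) sz zc /s /ifs_map.
    by field; lra.
  exists s; split => // u uc; rewrite -sc in uc.
  apply: unique_central_address uc => // n.
  have := @orb_address t s n t21 sc erefl (fun n _ => gap_orb n).
  have : 2 * t - 1 < (t^-1 - 1) * orb t^-1 n.
    by rewrite -gap_inv // ltr_pM2l.
  move=> lt_w e; move: lt_w; rewrite -e.
  have := address_value_itv (tail s n.+2) t01.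
  rewrite (address_value_tail _ n.+1 t01) /=.
  move: (address_value _ (tail s n.+2)) => V /andP[V0 V1].
  by rewrite ltr_normr; case: (z n); rewrite /ifs_map => /orP[]; nra.
elim/ltn_ind: N => N IH; rewrite ltNge; apply/negP => orbN.
have : `|2 * address_value t (tail s N.+1) - 1| <= 2 * t - 1.
  by rewrite orb_address // -gap_inv // ler_pM2l.
rewrite ler_norml => /andP[V0 V1].
set V := address_value t _ in V0 V1.
pose d := ~~ s N.+1.
pose y := (V - d%:R * (1 - t)) / t.
have yV : ifs_map t d y = V by rewrite ifs_mapE /y; field; lra.
have [u uy] : exists u, address_value t u = y.
  apply: address_exists; first by apply/andP; split; lra.
  by rewrite /y divr_ge0 ?ler_pdivrMr //=; case: (d) => /=; lra.
(* [s'] keeps the digits up to [N], takes the opposite digit at [N.+1] and goes on with an address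
   of the preimage [y]; [X] lists the values of its tails. *)
pose s' k := if (k <= N)%N then s k
             else if k == N.+1 then d else u (k - N.+2)%N.
pose X n := if (n <= N.+1)%N then address_value t (tail s n)
            else address_value t (tail u (n - N.+2)).
have : s' = s.
  apply: s_uniq => //; rewrite (@coded_orbit_address _ _ _ X) /X ?tail0 // => n.
    by case: ifP => _; exact: address_value_itv.
  rewrite /s'; case: (ltngtP n N.+1) => [nN|nN|->].
  - by rewrite -ltnS nN -(address_value_tail _ _ t01).
  - rewrite leqNgt (ltnW nN) /= subSn //.
    exact: address_value_tail (n - N.+2)%N t01.
  - by rewrite ltnn subnn tail0 uy yV.
by move/(congr1 (@^~ N.+1)); rewrite /s' /= ltnn eqxx /d; case: (s N.+1).
Qed.

End CentralPoint.

(** * Orbits of 1 that stay above the gap *)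

Section Dynamics.
Variable R : realType.
Implicit Types (q w d x : R).

Definition cubic q : R := 2 + 2 * q - q ^+ 3.

Lemma gapE q : 1 < q -> gap q * (q * (q - 1)) = 2 - q.
Proof. by move=> q1; rewrite /gap divfK // gt_eqF // mulr_gt0; lra. Qed.

Lemma orb1 q : 1 < q -> orb q 1 = q - 1.
Proof. by move=> q1; rewrite /orb /= mulr1 ger0_norm; lra. Qed.

Lemma orb3 q : 17 / 10 < q < 178 / 100 -> 
  orb q 2 = q ^+ 2 - q - 1 /\ orb q 3 = 1 + q + q ^+ 2 - q ^+ 3.
Proof.
move=> /andP[q1 q2]; have e2 : orb q 2 = q ^+ 2 - q - 1.
  by rewrite orbS orb1 ?ger0_norm; nra.
split=> //; rewrite orbS e2 ler0_norm; first by ring.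
have : q ^+ 2 - q - 1 < 39 / 100 by nra.
have : 0 < q ^+ 2 - q - 1 by nra.
nra.
Qed.

Lemma cubic_gt0_lt q : 1 < q -> 0 < cubic q -> q < 177 / 100.
Proof.
rewrite /cubic => q1 D0; rewrite ltNge; apply/negP => q2.
have : 31 / 10 <= q ^+ 2 by nra.
by nra.
Qed.

(** Iterate 1 excludes [q] up to 154/100, iterate 2 excludes it up to the golden ratio, where
    [q * (q - 1) - 1] changes sign, and then up to 171/100, and iterate 4 up to 174/100. *)
Lemma orbit_start q : 1 < q < 178 / 100 -> (forall n, gap q < orb q n) ->
  174 / 100 < q.
Proof.
move=> /andP[q1 q2] gap_orb; have cE := gapE q1.
have u0 : 0 < q * (q - 1) by nra.
have qA : 154 / 100 < q.
  have : gap q * (q * (q - 1)) < (q - 1) * (q * (q - 1)).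
    by rewrite ltr_pM2r // -(orb1 q1).
  rewrite cE ltNge => h; apply/negP; move: h; apply: contraNnot => q3.
  have : q * (q - 1) <= 21 / 25 by nra.
  by nra.
have qB : 1 < q * (q - 1).
  rewrite ltNge; apply/negP => u1; have := gap_orb 2; rewrite orbS orb1 //.
  rewrite ler0_norm; last by lra.
  move=> h; have : gap q * (q * (q - 1)) < - (q * (q - 1) - 1) * (q * (q - 1)).
    by rewrite ltr_pM2r.
  rewrite cE; have : 83 / 100 < q * (q - 1) by nra.
  have : q < 17 / 10 by nra.
  by nra.
have qC : 171 / 100 < q.
  rewrite ltNge; apply/negP => q3; have := gap_orb 2; rewrite orbS orb1 //.
  rewrite ger0_norm; last by lra.
  move=> h; have : gap q * (q * (q - 1)) < (q * (q - 1) - 1) * (q * (q - 1)).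
    by rewrite ltr_pM2r.
  rewrite cE; have : q * (q - 1) < 61 / 50 by nra.
  by nra.
rewrite ltNge; apply/negP => q3.
have q17 : 17 / 10 < q < 178 / 100 by apply/andP; split; lra.
have := gap_orb 4; rewrite orbS (orb3 q17).2 => h.
have c0 : 2 / 10 < gap q.
  rewrite ltNge; apply/negP => c1; have : q * (q - 1) <= 129 / 100 by nra.
  by nra.
have : `|q * (1 + q + q ^+ 2 - q ^+ 3) - 1| <= 2 / 10.
  have : q * (q - 1) <= 129 / 100 by nra.
  have : 6 / 5 <= q * (q - 1) by nra.
  have -> : 1 + q + q ^+ 2 - q ^+ 3 = q * (2 - q * (q - 1)) + 1 - q  by ring.
  by rewrite ler_norml => ? ?; apply/andP; split; nra.
by lra.
Qed.

Lemma expr_unbounded q x : 3 / 2 < q -> exists n, x < q ^+ (2 * n).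
Proof.
move=> q1; exists (Num.bound x).
apply: (@lt_le_trans _ _ (2 ^+ Num.bound x)); first exact: upper_nthrootP.
by rewrite exprM lerXn2r ?nnegrE ?exprn_ge0 //; nra.
Qed.

Lemma gap_bounds q : 174 / 100 < q < 177 / 100 ->
  1 / 6 < gap q < 21 / 100.
Proof.
move=> /andP[q1 q2].
have : gap q * (q * (q - 1)) = 2 - q by apply: gapE; lra.
move: (gap q) => c cE; have : q * (q - 1) < 15 / 11 by nra.
have u0 : 9 / 7 < q * (q - 1) by nra.
move=> u1; have u_gt0 : 0 < q * (q - 1) by apply: lt_trans u0; lra.
by apply/andP; split; rewrite -(ltr_pM2r u_gt0) cE; lra.
Qed.

(* Below 1/4 the orbit alternates between the two branches, so that the second
   iterate is the expanding affine map fixing [(q - 1) / (1 + q ^+ 2)]. *)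
Lemma orbit_two_cycle q m : 174 / 100 < q < 177 / 100 ->
  (forall n, gap q < orb q n) -> orb q m < 1 / 4 ->
  orb q m = (q - 1) / (1 + q ^+ 2).
Proof.
move=> q12 gap_orb om; have /andP[q1 q2] := q12.
have /andP[c1 c2] := gap_bounds q12.
set b := (q - 1) / (1 + q ^+ 2).
have bE : b = q - 1 - q ^+ 2 * b.
  by rewrite /b; field; have := sqr_ge0 q; lra.
have step k : orb q k < 1 / 4 ->
    orb q k.+2 < 1 / 4 /\ orb q k.+2 - b = - q ^+ 2 * (orb q k - b).
  move=> ok; have gk := gap_orb k; have := gap_orb k.+2.
  rewrite orbS [orb q k.+1]orbS.
  rewrite (ler0_norm (_ : q * orb q k - 1 <= 0)); last by nra.
  set w := orb q k in ok gk *.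
  rewrite ltr_normr => h.
  (* The value exceeds -1/6, so an absolute value above [gap q] forces it to be positive. *)
  have qw : 0 <= q * - (q * w - 1) - 1.
    have : 56 / 100 < - (q * w - 1) by nra.
    by case/orP: h => ?; nra.
  rewrite ger0_norm //; split; last by rewrite {1}bE; ring.
  have : - (q * w - 1) < 1 - 1 / 6 * q by nra.
  by nra.
have iter k : orb q (m + 2 * k) < 1 / 4 /\
    `|orb q (m + 2 * k) - b| = q ^+ (2 * k) * `|orb q m - b|.
  elim: k => [|k [IH1 IH2]]; first by rewrite addn0 [RHS]mul1r.
  have [h1 h2] := step _ IH1; rewrite mulnS addnCA addSn add1n; split=> //.
  rewrite h2 normrM IH2 normrN ger0_norm ?sqr_ge0 //.
  by rewrite mulrA exprD.
(* A nonzero distance would grow by the factor [q ^+ 2] forever, although both points stay in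
   [0, 1]. *)
apply/eqP; rewrite -subr_eq0 -normr_eq0; apply/negP => /negP ne0.
have pos : 0 < `|orb q m - b| by rewrite lt_neqAle eq_sym ne0 normr_ge0.
have [k] := @expr_unbounded q (`|orb q m - b|^-1) (ltac:(lra)).
rewrite -(ltr_pM2r pos) mulVf ?gt_eqF // -(iter k).2.
have b0 : 0 <= b <= 1.
  by rewrite /b divr_ge0 ?ler_pdivrMr; have := sqr_ge0 q; lra.
have := gap_orb (m + 2 * k)%N; have := (iter k).1; rewrite ltr_normr.
by move: b0 => /andP[b0 b1] ? ? /orP[]; lra.
Qed.

(** The displacement from the fixed point is a multiple of [cubic q], which is how beta enters. *)
Lemma orb3_fixpoint q : 174 / 100 < q < 177 / 100 ->
  orb q 3 = (q + 1)^-1 + q * cubic q / (q + 1).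
Proof.
move=> /andP[q1 q2]; have [|_ ->] := @orb3 q; first by apply/andP; split; lra.
by rewrite /cubic; field; lra.
Qed.

(** On the branch w |-> 1 - q w the displacement from the fixed point is multiplied by -q. Points
    below the fixed point are always on this branch, so the condition concerns the odd indices. *)
Lemma orbit_near_fixpoint q d j : 0 < q -> 0 <= d ->
  orb q 3 = (q + 1)^-1 + d ->
  (forall i, (i < j)%N -> q * ((q + 1)^-1 + q ^+ (2 * i) * d) <= 1) ->
  orb q (3 + 2 * j) = (q + 1)^-1 + q ^+ (2 * j) * d /\
  forall i, (i < j)%N -> orb q (4 + 2 * i) = (q + 1)^-1 - q ^+ (2 * i).+1 * d.
Proof.
move=> q0 d0 e3; set p := (q + 1)^-1.
have pE : q * p = 1 - p by rewrite /p; field; lra.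
have p1 : p < 1 by rewrite /p invf_lt1; lra.
elim: j => [_|j IH le1]; first by rewrite addn0 mul1r.
have [|IH1 IH2] := IH; first by move=> i ij; apply: le1; rewrite ltnS ltnW.
have e4 : orb q (4 + 2 * j) = p - q ^+ (2 * j).+1 * d.
  rewrite orbS IH1 ler0_norm ?subr_le0 ?le1 // mulrDr pE exprS; ring.
split; last first.
  by move=> i; rewrite ltnS leq_eqVlt => /predU1P[->//|]; exact: IH2.
have -> : (3 + 2 * j.+1 = (4 + 2 * j).+1)%N by rewrite mulnS.
rewrite orbS e4 mulrBr pE mulnS exprD (exprS _ (2 * j)).
rewrite ler0_norm; first by ring.
have : 0 <= q * (q * q ^+ (2 * j) * d).
  by rewrite !mulr_ge0 ?exprn_ge0 // ltW.
rewrite /p in p1 *.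
have : 0 < (q + 1)^-1 by rewrite invr_gt0; lra.
by lra.
Qed.

(* With [p = (q + 1)^-1] the fixed point and [a = (1 + q) / (1 + q ^+ 2)] the
   upper point of the 2-cycle of [w |-> `|q * w - 1|], the equation
   [parameter_eqn q n = 2] says [q ^+ (2 * n) * (orb q 3 - p) = a - p], i.e.
   that the orbit leaves the neighbourhood of [p] by landing exactly on [a]. *)
Definition parameter_eqn q n : R := q ^+ (2 * n) * cubic q * (1 + q ^+ 2).

(** At the first index [3 + 2 * n] where the branch 1 - q w would drop to [gap q] or below, survival
    forces the branch q w - 1. It leads below 1/4, hence onto the 2-cycle; equating the two formulas
    for that point gives the equation. *)
Lemma survivor_eqn q : 1 < q < 2 -> 0 < cubic q ->
  (forall n, gap q < orb q n) ->
  7 / 4 < q /\ exists n, parameter_eqn q n = 2.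
Proof.
move=> /andP[q1 q2] D0 gap_orb; have q3 := cubic_gt0_lt q1 D0.
have q4 : 174 / 100 < q by apply: orbit_start => //; apply/andP; split; lra.
have q12 : 174 / 100 < q < 177 / 100 by rewrite q4.
have /andP[c1 c2] := gap_bounds q12.
have e3 := orb3_fixpoint q12; set d := q * _ / _ in e3.
have d0 : 0 < d by rewrite /d divr_gt0 ?mulr_gt0 //; lra.
set p := (q + 1)^-1 in e3.
have pE : q * p = 1 - p by rewrite /p; field; lra.
have p0 : 0 < p by rewrite /p invr_gt0; lra.
have ex : exists n, 1 - gap q <= q * (p + q ^+ (2 * n) * d).
  have [n nP] := @expr_unbounded q d^-1 (ltac:(lra)).
  exists n; have : 1 < q ^+ (2 * n) * d by rewrite -ltr_pdivrMr // mul1r.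
  by nra.
case: (ex_minnP ex) => n nP n_min.
have lt_n i : (i < n)%N -> q * (p + q ^+ (2 * i) * d) < 1 - gap q.
  by move=> i_n; rewrite ltNge; apply/negP => /n_min; rewrite leqNgt i_n.
have [||o3 o4] := @orbit_near_fixpoint q d n _ (ltW d0) e3.
- by lra.
- by move=> i /lt_n; rewrite -/p; lra.
rewrite -/p in o3 o4.
have gt1 : gap q < q * orb q (3 + 2 * n) - 1.
  have := gap_orb (4 + 2 * n)%N; rewrite orbS ltr_normr => /orP[//|].
  by move: nP; rewrite -o3; lra.
have o4' : orb q (4 + 2 * n) = q * orb q (3 + 2 * n) - 1.
  by rewrite orbS ger0_norm //; lra.
have lt14 : orb q (4 + 2 * n) < 1 / 4.
  (* For [n = 0] the explicit fourth point suffices. Otherwise the preceding even iterate o exceeds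
     1/6, and two steps send it to q - 1 - q^2 o. *)
  rewrite o4' {o4' gt1 nP n_min lt_n}; case: n o3 o4 => [|n] o3 o4.
    have q17 : 17 / 10 < q < 178 / 100 by apply/andP; split; lra.
    have -> : orb q (3 + 2 * 0) = 1 + q * (1 - q * (q - 1)).
      by apply: (etrans (orb3 q17).2); ring.
    have u9 : 9 / 7 < q * (q - 1) by nra.
    by nra.
  rewrite o3; have := gap_orb (4 + 2 * n)%N; rewrite o4 // mulnS exprD.
  rewrite exprS; set y := q ^+ (2 * n) => h.
  have : q ^+ 2 * (p - q * y * d) > q ^+ 2 * (1 / 6).
    by rewrite ltr_pM2l; [lra|nra].
  have -> : q * (p + q ^+ 2 * y * d) - 1 =
      q - 1 - q ^+ 2 * (p - q * y * d) + (q * (q * p) + q * p - q) by ring.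
  rewrite pE; have -> : q * (1 - p) + (1 - p) - q = 0.
    by rewrite mulrBr pE; ring.
  have : q - 1 - q ^+ 2 * (1 / 6) < 1 / 4 by nra.
  by lra.
have ob := orbit_two_cycle q12 gap_orb lt14.
have q20 : 0 < q ^+ 2 by nra.
(* The lower cycle point exceeds [gap q], which amounts to [1 < q * (q - 1) ^+ 2]; this fails up to
   7/4. *)
split.
  have : gap q * (1 + q ^+ 2) < q - 1.
    by rewrite -ltr_pdivlMr ?addr_gt0 // -ob; exact: gap_orb.
  have u0 : 0 < q * (q - 1) by nra.
  move=> h; rewrite -(ltr_pM2r u0) [X in X < _]mulrAC gapE // in h.
  have {h} : 1 < q * (q - 1) ^+ 2 by rewrite !expr2 in h *; nra.
  rewrite expr2 => h; rewrite ltNge; apply/negP => q5.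
  have : (q - 1) * (q - 1) <= 9 / 16 by nra.
  by nra.
exists n; have : q ^+ (2 * n) * d = (1 + (q - 1) / (1 + q ^+ 2)) / q - p.
  by rewrite -ob o4' o3; field; lra.
rewrite /parameter_eqn => yd.
have -> : q ^+ (2 * n) * cubic q * (1 + q ^+ 2) =
    (q ^+ (2 * n) * d) * ((q + 1) * (1 + q ^+ 2) / q).
  by rewrite /d; field; lra.
by rewrite yd /p; field; lra.
Qed.

(** The orbit oscillates away from the fixed point, with low points no lower than the lower cycle
    point [b], then lands on the 2-cycle and stays there. The bound 351/200 lies just above the root
    of q (q - 1)^2 = 1, where [b] equals [gap q]. *)
Lemma eqn_survivor q n : 351 / 200 < q < 177 / 100 -> 0 < cubic q ->
  parameter_eqn q n = 2 -> forall m, gap q < orb q m.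
Proof.
move=> /andP[q1 q2] D0 eqn.
have q12 : 174 / 100 < q < 177 / 100 by apply/andP; split; lra.
have /andP[c1 c2] := gap_bounds q12.
have e3 := orb3_fixpoint q12; set d := q * _ / _ in e3.
have d0 : 0 < d by rewrite /d divr_gt0 ?mulr_gt0 //; lra.
set p := (q + 1)^-1 in e3.
have pE : q * p = 1 - p by rewrite /p; field; lra.
have q20 : 0 < q ^+ 2 by nra.
pose a := (1 + q) / (1 + q ^+ 2); pose b := (q - 1) / (1 + q ^+ 2).
have aE : q * a = 1 + b by rewrite /a /b; field; lra.
have bE : q * b = 1 - a by rewrite /a /b; field; lra.
have cb : gap q < b.
  rewrite /b ltr_pdivlMr ?addr_gt0 //.
  have u0 : 0 < q * (q - 1) by nra.
  rewrite -(ltr_pM2r u0) [X in X < _]mulrAC gapE; last by lra.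
  have : 57 / 100 < (q - 1) * (q - 1) by nra.
  by rewrite expr2; nra.
have yd : q ^+ (2 * n) * d = a - p.
  have -> : q ^+ (2 * n) * d =
      parameter_eqn q n * q / ((q + 1) * (1 + q ^+ 2)).
    by rewrite /parameter_eqn /d; field; lra.
  by rewrite eqn /a /p; field; lra.
have mon i j : (i <= j)%N -> q ^+ i * d <= q ^+ j * d.
  by move=> ij; rewrite ler_pM2r // ler_eXn2l //; lra.
have ap i : (i < n)%N -> q ^+ (2 * i).+2 * d <= a - p.
  by move=> i_n; rewrite -yd mon // -[(2 * i).+2](mulnS 2 i) leq_mul2l.
(* Since [q * (p - b) = a - p], division by [q] turns the bound above the fixed point into one below
   it. *)
have apb i : (i < n)%N -> q ^+ (2 * i).+1 * d <= p - b.
  move=> /ap; have -> : q ^+ (2 * i).+2 * d = q * (q ^+ (2 * i).+1 * d).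
    by rewrite exprS mulrA.
  by move=> h; rewrite -(ler_pM2l (_ : 0 < q)); lra.
have b0 : 0 < b by lra.
have [||o3 o4] := @orbit_near_fixpoint q d n _ (ltW d0) e3.
- by lra.
- by move=> i /apb; rewrite -/p mulrDr pE mulrA -exprS; lra.
rewrite -/p in o3 o4.
have p0 : 0 < p by rewrite /p invr_gt0; lra.
have tail3 k : orb q (3 + 2 * n + 2 * k) = a.
  elim: k => [|k IH]; first by rewrite addn0 o3 yd; ring.
  rewrite mulnS addnCA addSn add1n orbS orbS IH aE.
  rewrite (ger0_norm (_ : 0 <= 1 + b - 1)); last by lra.
  have a0 : 0 < a by rewrite /a divr_gt0; lra.
  by rewrite ler0_norm; lra.
have tail4 k : orb q (4 + 2 * n + 2 * k) = b.
  rewrite (_ : (4 + 2 * n + 2 * k = (3 + 2 * n + 2 * k).+1)%N) //.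
  by rewrite orbS tail3 aE ger0_norm; lra.
have ab : b < a by rewrite /a /b ltr_pM2r ?invr_gt0; lra.
have o2 : orb q 2 = q ^+ 2 - q - 1 by apply: (orb3 _).1; apply/andP; split; lra.
have main j : gap q < orb q (3 + 2 * j) /\ gap q < orb q (4 + 2 * j).
  case: (ltnP j n) => jn.
    have [||-> _] := @orbit_near_fixpoint q d j _ (ltW d0) e3.
    - by lra.
    - move=> i ij; have := apb i (ltn_trans ij jn).
      by rewrite -/p mulrDr pE mulrA -exprS; lra.
    rewrite (o4 _ jn).
    have := apb _ jn; have : 0 <= q ^+ (2 * j) * d.
      by rewrite mulr_ge0 ?exprn_ge0 // ?ltW //; lra.
    have : 0 < q ^+ (2 * j).+1 * d by rewrite mulr_gt0 ?exprn_gt0 //; lra.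
    rewrite -/p => ? ? ?; split; lra.
  have e k : (k + 2 * j = k + 2 * n + 2 * (j - n))%N.
    by rewrite -addnA -mulnDr subnKC.
  by rewrite (e 3%N) (e 4%N) tail3 tail4; split; lra.
case=> [|[|[|m]]].
- by rewrite /orb /=; lra.
- by rewrite orb1; lra.
- by rewrite o2; nra.
- have [m3 m4] := main m./2; rewrite mul2n in m3 m4.
  by rewrite -(odd_double_half m); case: (odd m); [exact: m4|exact: m3].
Qed.

End Dynamics.

(** * Uncountably many parameters near 1/2 *)

Section Uncountable.
Variable R : realType.
Implicit Types (t u : R) (s x : nat -> bool).

Definition pair_blocks x : nat -> bool :=
  fun k => if odd k then ~~ x k./2 else x k./2.

(* The blocks [x i, ~~ x i] forbid three equal digits in a row, and the six
   leading ones force the parameter close to 1/2. *)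
Definition block_address x : nat -> bool := fun k =>
  match k with 0 => false | k'.+4.+3 => pair_blocks x k' | _ => true end%N.

Lemma block_address_inj : injective block_address.
Proof.
move=> x y exy; apply/funext => i.
have := congr1 (@^~ (i.*2).+4.+3) exy.
by rewrite /= /pair_blocks odd_double doubleK.
Qed.

Lemma pair_blocks_hit x i b :
  exists2 j, (j <= 1)%N & pair_blocks x (i.*2 + j) = b.
Proof.
have [<-|xb] := eqVneq (x i) b.
  by exists 0%N; rewrite // addn0 /pair_blocks odd_double doubleK.
exists 1%N; rewrite // addn1 /pair_blocks /= odd_double /= uphalf_double.
by case: (x i) b xb => -[].
Qed.

(** Among the leading ones the next digit agrees. From the sixth one on, the next full block ends at
    most three places later and contains both digits. *)
Lemma block_address_window x n :
  exists2 j, (j <= 2)%N & tail (block_address x) n.+2 j = block_address x n.+1.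
Proof.
case: n => [|[|[|[|[|[|n]]]]]]; try by exists 0%N.
  have [j j1 e] := pair_blocks_hit x 0 true.
  by exists j => //; rewrite (leq_trans j1).
set b := block_address x _.
have [j j1 e] := pair_blocks_hit x (n./2).+1 b.
exists (~~ odd n + j)%N; first by case: (odd n); rewrite //= (leq_trans j1).
rewrite -e /tail.
have -> : (n.+4.+4 + (~~ odd n + j) = ((n./2).+1.*2 + j).+4.+3)%N.
  rewrite -{1}(odd_double_half n) doubleS.
  by case: (odd n); rewrite /= ?add0n ?add1n ?addSn ?addnS.
by [].
Qed.

Lemma address_value_ge t s j : 0 < t < 1 -> s j ->
  (1 - t) * t ^+ j <= address_value t s.
Proof.
move=> t01; have /andP[t0 t1] := t01.
elim: j s => [|j IH] s sj; rewrite (address_valueE _ t01).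
  have /andP[V0 V1] := address_value_itv (s \o S) t01.
  by rewrite sj /ifs_map mulr1; nra.
apply: (@le_trans _ _ (t * address_value t (s \o S))).
  by rewrite exprS mulrCA ler_pM2l // IH.
by rewrite ifs_mapE lerDl mulr_ge0 // subr_ge0 ltW.
Qed.

(** The digit recurring within three places moves the point at least 1/2 * 3/25 = 3/50 away from the
    inner end of its image, while the overlap has length 2 t - 1 <= 1/25. *)
Lemma block_address_out t x n : 1 / 2 <= t <= 13 / 25 ->
  if block_address x n.+1
  then t < address_value t (tail (block_address x) n.+1)
  else address_value t (tail (block_address x) n.+1) < 1 - t.
Proof.
set s := block_address x; move=> /andP[th t1].
have t01 : 0 < t < 1 by apply/andP; split; lra.
have [j j2] := block_address_window x n; rewrite -/s.
rewrite (address_value_tail _ n.+1 t01).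
have t2 : 1 / 4 <= t ^+ j.
  apply: (@le_trans _ _ (t ^+ 2)); first by nra.
  by rewrite ler_wiXn2l //; lra.
have t2' : 3 / 25 <= (1 - t) * t ^+ j by nra.
case: (s n.+1) => sj.
  have := address_value_ge t01 sj.
  by rewrite /ifs_map; nra.
have : (negb \o tail s n.+2) j by rewrite /= sj.
move/(address_value_ge t01); rewrite address_value_compl //.
by rewrite /ifs_map; nra.
Qed.

Lemma block_address_valueE t x : 0 < t < 1 ->
  address_value t (block_address x) =
  t * (1 - t ^+ 6 * (1 - address_value t (tail (block_address x) 7))).
Proof.
set s := block_address x; move=> t01; rewrite -{1}[s]tail0.
do 7!rewrite (address_value_tail _ _ t01) [ifs_map _ _ _]/=.
rewrite /ifs_map /=; ring.
Qed.

(** The constant 5/2 solves C = 3/5 C + 1: each step contracts by at most 3/5, and changing the map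
    costs at most [|t - u|]. Being independent of [k], it passes to the limit. *)
Lemma ifs_comp_lipschitz t u s k : 0 < t <= 3 / 5 -> 0 < u <= 3 / 5 ->
  `|ifs_comp t s k 0 - ifs_comp u s k 0| <= 5 / 2 * `|t - u|.
Proof.
move=> /andP[t0 t1] /andP[u0 u1]; elim: k s => [|k IH] s.
  by rewrite /ifs_comp /= subrr normr0 mulr_ge0 //; lra.
rewrite !ifs_compS; have {}IH := IH (s \o S).
have : 0 <= ifs_comp u (s \o S) k 0 <= 1.
  by apply: ifs_comp_itv; rewrite ?lexx ?ler01 //; apply/andP; split; lra.
move: (ifs_comp t _ _ _) (ifs_comp u _ _ _) IH => a b IH /andP[b0 b1].
have -> : ifs_map t (s 0%N) a - ifs_map u (s 0%N) b =
    t * (a - b) + (b - (s 0%N)%:R) * (t - u) by rewrite !ifs_mapE; ring.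
apply: le_trans (ler_normD _ _) _; rewrite !normrM (gtr0_norm t0).
have : `|b - (s 0%N)%:R| <= 1.
  by rewrite ler_norml; case: (s 0%N) => /=; apply/andP; split; lra.
have := normr_ge0 (a - b); have := normr_ge0 (t - u).
move: `|a - b| `|t - u| `|b - _| IH => A B C IH A0 B0 C1.
have : t * A <= 3 / 5 * (5 / 2 * B) by apply: ler_pM => //; lra.
have : C * B <= 1 * B by rewrite ler_wpM2r.
by lra.
Qed.

Lemma address_value_lipschitz t u s : 0 < t <= 3 / 5 -> 0 < u <= 3 / 5 ->
  `|address_value t s - address_value u s| <= 5 / 2 * `|t - u|.
Proof.
move=> t1 u1.
have cv (v : R) : 0 < v <= 3 / 5 -> is_address v s (address_value v s).
  by move=> /andP[? ?]; apply: is_address_value; apply/andP; split; lra.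
have cvB : `|ifs_comp t s k 0 - ifs_comp u s k 0| @[k --> \oo] -->
    `|address_value t s - address_value u s|.
  by apply: cvg_norm; apply: cvgB; exact: cv.
rewrite -(cvg_lim _ cvB) //; apply: limr_le.
  by apply/cvg_ex; eexists; exact: cvB.
by apply: nearW => k; exact: ifs_comp_lipschitz.
Qed.

Lemma address_value_continuous s :
  {within `[1 / 2, 13 / 25], continuous (fun t : R => address_value t s)}.
Proof.
apply: continuous_subspace_itv => t; rewrite in_itv /= => /andP[t0 t1].
apply/cvgrPdist_lt => e e0.
(* The bound 1/20 keeps [u] in (0, 3/5], and 5/2 times e/3 is less than [e]. *)
near=> u; have tu : `|t - u| < Num.min (e / 3) (1 / 20).
  near: u; apply: cvgr_dist_lt; first exact: cvg_id.
  by rewrite lt_min; apply/andP; split; lra.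
move: tu; rewrite lt_min => /andP[tu1 tu2].
move: tu2; rewrite ltr_norml => /andP[tu2 tu3].
apply: le_lt_trans (address_value_lipschitz s _ _) _; last by lra.
  by apply/andP; split; lra.
by apply/andP; split; lra.
Unshelve. all: by end_near. Qed.

(** At 1/2 the value is below 1/2, strictly because some block digit is 0; this keeps the solution
    away from 1/2. At 13/25 the small factor [t ^+ 6] makes it at least 1/2. *)
Lemma block_address_parameter x : exists t : R,
  two_address_parameters t /\ address_value t (block_address x) = 1 / 2.
Proof.
set s := block_address x.
have lo : @address_value R (1 / 2) s < 1 / 2.
  have t01 : 0 < (1 / 2 : R) < 1 by apply/andP; split; lra.
  rewrite (block_address_valueE x t01) -/s.
  have V7 : address_value (1 / 2 : R) (tail s 7) < 1.
    have [j _ sj] := pair_blocks_hit x 0 false.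
    have : (negb \o tail s 7) j by rewrite /= /tail /s /= sj.
    move/(address_value_ge t01); rewrite address_value_compl // => le.
    rewrite -subr_gt0; apply: lt_le_trans le.
    by rewrite mulr_gt0 ?exprn_gt0 //; lra.
  have t6 : 0 < (1 / 2 : R) ^+ 6 by rewrite exprn_gt0 //; lra.
  have : 0 < (1 / 2) ^+ 6 * (1 - address_value (1 / 2 : R) (tail s 7)).
    by rewrite mulr_gt0 // subr_gt0.
  by lra.
have hi : 1 / 2 <= @address_value R (13 / 25) s.
  have t01 : 0 < (13 / 25 : R) < 1 by apply/andP; split; lra.
  rewrite (block_address_valueE x t01) -/s.
  have /andP[V0 V1] := address_value_itv (tail s 7) t01.
  have t6 : 0 <= (13 / 25 : R) ^+ 6 <= 1 / 40 by apply/andP; split; lra.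
  by nra.
have [t] := @IVT R (fun t => address_value t s) (1 / 2) (13 / 25) (1 / 2)
  (ltac:(lra)) (address_value_continuous (s := s))
  (ltac:(rewrite ge_min le_max hi (ltW lo) orbT //)).
rewrite in_itv /= => /andP[t0 t1] ts; exists t; split => //.
have t2 : 1 / 2 < t.
  rewrite lt_neqAle t0 andbT; apply/eqP => te; move: lo.
  by rewrite [X in address_value X _]te ts ltxx.
have t01 : 1 / 2 < t < 1 by apply/andP; split; lra.
apply/(two_address_parametersP t01); exists s; split => // u uc.
rewrite -ts in uc; apply: unique_central_address uc => //.
  by apply/andP; split; lra.
by move=> n; apply: block_address_out; rewrite t0.
Qed.

Lemma uncountable_sequences : ~ countable [set: nat -> bool].
Proof.
move=> /countable_injP[f f_inj].
(* Cantor's diagonal: [g n] negates digit [n] of the sequence numbered [n], and is true if there is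
   none. *)
pose g n := ~~ `[< exists x, f x = n /\ x n >].
have : g (f g) = ~~ g (f g).
  congr negb; apply/asboolP/idP => [[x [/f_inj <-]]|gg]; rewrite ?inE //.
  by exists g.
by case: (g _).
Qed.

(** A parameter determines its central address starting with 0, so different block sequences give
    different parameters. *)
Lemma two_address_parameters_uncountable :
  ~ countable (@two_address_parameters R).
Proof.
move=> /countable_injP[f f_inj]; apply: uncountable_sequences.
apply/countable_injP.
have /choice[T TP] := block_address_parameter.
exists (f \o T) => x y _ _ /= fT; have [Px Vx] := TP x; have [Py Vy] := TP y.
have eT : T x = T y by apply: f_inj => //; exact/mem_set.
have [s [_ _ s_uniq]] := (two_address_parametersP Px.1).1 Px.
apply: block_address_inj.
by rewrite (s_uniq _ Vx) // (s_uniq (block_address y)) // eT.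
Qed.

End Uncountable.

(** * Solutions of the equations, limit points and isolated points *)

Lemma finite_roots (F : idomainType) (p : {poly F}) :
  p != 0 -> finite_set [set x | root p x].
Proof.
move=> p0; apply: contrapT => /(@infinite_set_fset _ _ (size p))[B Bp].
rewrite leqNgt; apply/negP/negPn; apply: max_poly_roots => //.
  by apply/allP => x xB; exact: Bp.
exact: finmap.fset_uniq.
Qed.

Section CentralParameters.
Variable R : realType.
Implicit Types (q t x y : R).

Lemma cubic_decreasing x y : 1 <= x -> x < y -> cubic y < cubic x.
Proof.
move=> x1 xy; rewrite -subr_gt0 /cubic.
have -> : 2 + 2 * x - x ^+ 3 - (2 + 2 * y - y ^+ 3) =
  (y - x) * (y ^+ 2 + y * x + x ^+ 2 - 2) by ring.
by rewrite mulr_gt0 ?subr_gt0 //; nra.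
Qed.

Lemma cubic_le q : 7 / 4 < q -> cubic q <= 1 / 7.
Proof.
move=> q1; have : cubic q < cubic (7 / 4) by apply: cubic_decreasing; lra.
have : cubic (7 / 4 : R) <= 1 / 7 by rewrite /cubic; lra.
by lra.
Qed.

(** The endpoints are close enough for [1 / b] to round to .5652. *)
Lemma cubic_root : exists b : R, 23 / 13 <= b <= 660 / 373 /\ cubic b = 0.
Proof.
pose p : {poly R} := 'X^3 - 2 *: 'X - 2%:P.
have pE x : p.[x] = - cubic x by rewrite /p !hornerE /cubic; ring.
have [||b b_itv /rootP pb] := @poly_ivt R p (23 / 13) (660 / 373).
- by lra.
- by rewrite !pE /cubic; apply/andP; split; lra.
- by exists b; split => //; rewrite -[LHS]opprK -pE pb oppr0.
Qed.

(** In the product [N q * cubic q] the cubic falls with slope at least 7 against [N x >= 30], while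
    [N] rises with slope at most 140 against [cubic y <= 1 / 7]; and 210 > 20. *)
Lemma parameter_eqn2_decreasing x y : 7 / 4 <= x -> x < y -> 0 <= cubic y ->
  parameter_eqn y 2 < parameter_eqn x 2.
Proof.
move=> x1 xy Dy.
have Dx : 0 < cubic x by apply: le_lt_trans (cubic_decreasing _ xy) => //; lra.
have y1 : y < 178 / 100.
  rewrite ltNge; apply/negP => y1; move: Dy; rewrite /cubic.
  have y2 : 316 / 100 <= y ^+ 2 by nra.
  by rewrite exprS; nra.
have Dy' := cubic_le (le_lt_trans x1 xy).
have hD : (y - x) * 7 <= cubic x - cubic y.
  have -> : cubic x - cubic y = (y - x) * (y ^+ 2 + y * x + x ^+ 2 - 2).
    by rewrite /cubic; ring.
  by rewrite ler_pM2l ?subr_gt0 //; nra.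
pose N q := q ^+ 4 * (1 + q ^+ 2).
have eqnE q : parameter_eqn q 2 = N q * cubic q.
  by rewrite /parameter_eqn /N; ring.
have x2 : 3 <= x ^+ 2 <= 32 / 10 by apply/andP; split; nra.
have y2 : 3 <= y ^+ 2 <= 32 / 10 by apply/andP; split; nra.
have hN : N y - N x <= (y - x) * 140.
  have -> : N y - N x = (y - x) * ((y + x) * (y ^+ 2 + x ^+ 2 +
      (y ^+ 2 * y ^+ 2 + y ^+ 2 * x ^+ 2 + x ^+ 2 * x ^+ 2))).
    by rewrite /N; ring.
  rewrite ler_pM2l ?subr_gt0 //.
  move: (x ^+ 2) (y ^+ 2) x2 y2 => X Y /andP[X0 X1] /andP[Y0 Y1].
  have : Y * Y <= 32 / 10 * (32 / 10) by apply: ler_pM => //; lra.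
  have : Y * X <= 32 / 10 * (32 / 10) by apply: ler_pM => //; lra.
  have : X * X <= 32 / 10 * (32 / 10) by apply: ler_pM => //; lra.
  move=> XX YX YY.
  apply: (@le_trans _ _ (36 / 10 * 38)); last by lra.
  have XX0 : 0 <= X * X by apply: mulr_ge0; lra.
  have YX0 : 0 <= Y * X by apply: mulr_ge0; lra.
  have YY0 : 0 <= Y * Y by apply: mulr_ge0; lra.
  by apply: ler_pM; lra.
have Nx : 30 <= N x.
  have -> : N x = x ^+ 2 * x ^+ 2 * (1 + x ^+ 2) by rewrite /N; ring.
  by move: (x ^+ 2) x2 => X /andP[X0 X1]; nra.
have : (y - x) * 7 * 30 <= (cubic x - cubic y) * N x.
  by apply: ler_pM => //; lra.
have : cubic y * (N y - N x) <= 1 / 7 * ((y - x) * 140).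
  apply: (@le_trans _ _ (cubic y * ((y - x) * 140))).
    by rewrite ler_wpM2l.
  by rewrite ler_wpM2r //; nra.
by rewrite !eqnE; nra.
Qed.

(** As [cubic q <= 1 / 7], the left side of the equation is still below 2 for the indices 0 and
    1. *)
Lemma survivor_index q : 7 / 4 < q -> 0 < cubic q -> forall n,
  parameter_eqn q n = 2 -> (1 < n)%N.
Proof.
move=> q1 Dq n; have q2 : q < 177 / 100 by apply: cubic_gt0_lt => //; lra.
have Dq' := cubic_le q1.
have q20 : 0 < q ^+ 2 < 315 / 100 by apply/andP; split; nra.
have lt2 : q ^+ 2 * cubic q * (1 + q ^+ 2) < 2.
  by move: (q ^+ 2) q20 => Q /andP[Q0 Q1]; nra.
case: n => [|[|//]]; rewrite /parameter_eqn ?muln0 ?muln1 => e; last lra.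
by move: e lt2; rewrite expr0 => e; move: (q ^+ 2) q20 e => Q /andP[Q0 Q1]; nra.
Qed.

Definition eqn_poly n : {poly R} :=
  2%:P - 'X^(2 * n) * (2%:P + 2 *: 'X - 'X^3) * (1 + 'X^2).

Lemma horner_eqn_poly n x : (eqn_poly n).[x] = 2 - parameter_eqn x n.
Proof. by rewrite /eqn_poly !hornerE /parameter_eqn /cubic. Qed.

Lemma eqn_root lo hi n : lo <= hi -> 2 <= parameter_eqn lo n ->
  parameter_eqn hi n <= 2 ->
  exists2 q : R, lo <= q <= hi & parameter_eqn q n = 2.
Proof.
move=> lo_hi lo2 hi2.
have [||q q_itv /rootP] := @poly_ivt R (eqn_poly n) lo hi => //.
  by rewrite !horner_eqn_poly subr_le0 subr_ge0 lo2.
by rewrite horner_eqn_poly => /eqP; rewrite subr_eq0 eq_sym => /eqP; exists q.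
Qed.

Section Beta.
Variable b : R.
Hypotheses (b_itv : 23 / 13 <= b <= 660 / 373) (b_root : cubic b = 0).

Lemma cubic_gt0 q : 1 <= q -> q < b -> 0 < cubic q.
Proof. by move=> q1 qb; rewrite -b_root cubic_decreasing. Qed.

Lemma eqn_beta n : parameter_eqn b n = 0.
Proof. by rewrite /parameter_eqn b_root mulr0 mul0r. Qed.

Lemma b_gt0 : 0 < b. Proof. by case/andP: b_itv => ? _; lra. Qed.

Lemma eqn_parameter q n : 351 / 200 < q -> q < b -> parameter_eqn q n = 2 ->
  two_address_parameters q^-1.
Proof.
move=> q1 qb eqn; have /andP[_ b2] := b_itv.
have q0 : 0 < q by lra.
have q12 : 1 / 2 < q^-1 < 1.
  by rewrite div1r ltf_pV2 ?posrE // invf_lt1 //; apply/andP; split; lra.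
apply/(two_address_parameters_orb q12); rewrite invrK.
by apply: eqn_survivor eqn; [apply/andP; split|apply: cubic_gt0 => //]; lra.
Qed.

Lemma parameter_solves t : two_address_parameters t -> b^-1 < t ->
  [/\ 7 / 4 < t^-1, t^-1 < b &
    exists2 n, (1 < n)%N & parameter_eqn t^-1 n = 2].
Proof.
move=> Pt bt; have := Pt.1 => /andP[t2 t1].
have t0 : 0 < t by lra.
have tb : t^-1 < b by rewrite -[b]invrK ltf_pV2 ?posrE ?invr_gt0 ?b_gt0.
have ti1 : 1 < t^-1 by rewrite invf_gt1.
have ti2 : t^-1 < 2 by rewrite -[2]invrK ltf_pV2 ?posrE ?invr_gt0 //; lra.
have D0 := cubic_gt0 (ltW ti1) tb.
have [||lt7 [n eqn]] := survivor_eqn _ D0; last first.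
- by split => //; exists n => //; exact: survivor_index eqn.
- by apply/two_address_parameters_orb; first exact: Pt.1.
- by apply/andP.
Qed.

Lemma eqn_ge_pow q n m : 7 / 4 < q -> 0 < cubic q -> (m <= n)%N ->
  q ^+ (2 * m) * cubic q <= parameter_eqn q n.
Proof.
move=> q1 D0 mn; rewrite /parameter_eqn -[leLHS]mulr1; apply: ler_pM => //.
- by rewrite mulr_ge0 ?exprn_ge0 // ?ltW //; lra.
- by rewrite ler_pM2r // ler_eXn2l ?leq_mul2l ?mn ?orbT //; lra.
- by rewrite lerDl sqr_ge0.
Qed.

(** Away from [b] the cubic is bounded below, so the growing power of [q] bounds the index [n]; each
    index contributes finitely many roots. *)
Lemma finite_parameters_above m : b^-1 < m ->
  finite_set ([set t | m < t] `&` @two_address_parameters R).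
Proof.
move=> bm; have b0 := b_gt0; have /andP[b1 b2] := b_itv.
have m0 : 0 < m by apply: lt_trans bm; rewrite invr_gt0.
have mb : m^-1 < b by rewrite -[b]invrK ltf_pV2 ?posrE ?invr_gt0.
have [m1|m1] := leP 1 m.
  apply: (@sub_finite_set _ _ set0); last exact: finite_set0.
  by move=> t [/= mt [/andP[_ t1] _]]; lra.
have mi1 : 1 < m^-1 by rewrite invf_gt1.
have d0 : 0 < cubic m^-1 by apply: cubic_gt0 => //; exact: ltW.
have [k kP] := @expr_unbounded R (7 / 4) (2 / cubic m^-1) (ltac:(lra)).
apply: (@sub_finite_set _ _
    (\bigcup_(n in `I_k) (GRing.inv @` [set q | root (eqn_poly n) q]))).
  move=> t [/= mt Pt]; have bt := lt_trans bm mt.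
  have [t7 tb [n n1 eqn]] := parameter_solves Pt bt.
  exists n => /=; last first.
    exists t^-1; rewrite ?invrK //=; apply/rootP.
    by rewrite horner_eqn_poly eqn subrr.
  rewrite ltnNge; apply/negP => kn.
  have tm : t^-1 < m^-1 by rewrite ltf_pV2 ?posrE //; exact: lt_trans mt.
  have D : cubic m^-1 < cubic t^-1 by apply: cubic_decreasing => //; lra.
  have := eqn_ge_pow t7 (lt_trans d0 D) kn; rewrite eqn leNgt => /negP; apply.
  move: kP; rewrite ltr_pdivrMr // => kP; apply: lt_le_trans kP _.
  apply: ler_pM; [by rewrite exprn_ge0 //; lra|exact: ltW| |exact: ltW].
  by rewrite lerXn2r ?nnegrE; lra.
apply: bigcup_finite => [|n _]; first exact: finite_II.
apply: finite_image; apply: finite_roots; apply/eqP => p0.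
(* The polynomial takes the value 2 at [b], so it is not zero. *)
have := horner_eqn_poly n b; rewrite p0 horner0 eqn_beta => /eqP.
by rewrite subr0 eq_sym pnatr_eq0.
Qed.

Lemma limit_point_le x : limit_point (@two_address_parameters R) x -> x <= b^-1.
Proof.
move=> lx; rewrite leNgt; apply/negP => bx.
pose m := (b^-1 + x) / 2.
have bm : b^-1 < m by rewrite /m; lra.
have /limit_point_infinite_setP/(_ [set t | m < t]) := lx; apply.
  by apply: lt_nbhsr; rewrite /m; lra.
exact: finite_parameters_above.
Qed.

(** The left side of the equation vanishes at [b] and exceeds 2 at [lo] once [n] is large, so a
    solution lies between. *)
Lemma parameter_between lo : 351 / 200 < lo -> lo < b ->
  exists q, [/\ lo <= q, q < b & two_address_parameters q^-1].
Proof.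
move=> lo1 lob; have d0 : 0 < cubic lo by apply: cubic_gt0 => //; lra.
have [n nP] := @expr_unbounded R lo (2 / cubic lo) (ltac:(lra)).
have [||q /andP[q1 q2] eqn] := @eqn_root lo b n (ltW lob).
- apply: le_trans (eqn_ge_pow _ d0 (leqnn n)); last by lra.
  by rewrite ltW // -ltr_pdivrMr.
- by rewrite eqn_beta.
have qb : q < b.
  rewrite lt_neqAle q2 andbT; apply/eqP => qb; move: eqn; rewrite qb eqn_beta.
  by lra.
by exists q; split => //; apply: eqn_parameter eqn => //; lra.
Qed.

Lemma limit_point_beta : limit_point (@two_address_parameters R) b^-1.
Proof.
move=> U /nbhs_ballP[e /= e0 eU]; have b0 := b_gt0; have /andP[b1 b2] := b_itv.
pose h := (b^-1 + e / 2)^-1.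
have be : b^-1 < b^-1 + e / 2 by lra.
have hb : h < b.
  by rewrite -[b]invrK ltf_pV2 ?posrE ?invr_gt0 // addr_gt0 ?invr_gt0 //; lra.
(* [h] keeps the reciprocal within e/2 of [b^-1]; 44/25 lies between 351/200 and [b]. *)
have [||q [q1 qb Pq]] := @parameter_between (Num.max h (44 / 25)).
- by rewrite lt_max; apply/orP; right; lra.
- by rewrite gt_max hb; lra.
move: q1; rewrite ge_max => /andP[hq q44].
have q0 : 0 < q by lra.
exists q^-1; split => //; first by rewrite gt_eqF // ltf_pV2.
apply: eU; rewrite /ball /= ltr_norml.
have : q^-1 <= b^-1 + e / 2.
  rewrite -[leRHS]invrK -/h lef_pV2 ?posrE // invr_gt0 addr_gt0 ?invr_gt0 //.
  by lra.
have : b^-1 < q^-1 by rewrite ltf_pV2.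
by move=> ? ?; apply/andP; split; lra.
Qed.

(** The solution with index 2 is isolated because it lies above every limit point. A larger
    parameter would have a smaller reciprocal and index at least 2, which makes the left side of its
    equation exceed 2. The endpoints make [q^-1] round to .5674. *)
Lemma largest_isolated : exists q, [/\ 178 / 101 <= q, q <= 141 / 80 &
  is_largest (isolated (@two_address_parameters R)) q^-1].
Proof.
have b0 := b_gt0; have /andP[b1 b2] := b_itv.
have [|||q /andP[q1 q2] eqn] := @eqn_root (178 / 101) (141 / 80) 2.
- by lra.
- by rewrite /parameter_eqn /cubic; lra.
- by rewrite /parameter_eqn /cubic; lra.
have qb : q < b by lra.
have q0 : 0 < q by lra.
have bq : b^-1 < q^-1 by rewrite ltf_pV2.
exists q; split => //; split.
  have Pq : two_address_parameters q^-1 by apply: eqn_parameter eqn => //; lra.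
  have : closure (@two_address_parameters R) q^-1 by exact: subset_closure.
  rewrite closure_isolated_limit_point => -[//|/limit_point_le].
  by rewrite leNgt bq.
move=> t /isolatedS Pt; rewrite leNgt; apply/negP => qt.
have t0 : 0 < t by case: Pt => /andP[? _] _; lra.
have [t7 tb [n n1 eqnt]] := parameter_solves Pt (lt_trans bq qt).
have tq : t^-1 < q by rewrite -[q]invrK ltf_pV2 ?posrE ?invr_gt0.
have := @parameter_eqn2_decreasing t^-1 q (ltW t7) tq (ltW (cubic_gt0 _ qb)).
rewrite eqn => /(_ (ltac:(lra))); apply/negP; rewrite -leNgt -eqnt.
rewrite /parameter_eqn ler_pM2r ?ler_pM2r.
- by rewrite ler_eXn2l ?leq_mul2l //; lra.
- by apply: cubic_gt0 => //; lra.
- by have := sqr_ge0 t^-1; lra.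
Qed.

End Beta.
End CentralParameters.

Theorem theorem18 (R : realType) :
  let P := @two_address_parameters R in
  [/\ ~ countable P,
      exists beta : R,
        [/\ forall x : R, root ('X^3 - 2 *: 'X - 2%:P) x <-> x = beta,
            approx4 (1 / beta) (5652 / 10 ^+ 4)
          & is_largest (limit_point P) (1 / beta)]
    & exists t : R, approx4 t (5674 / 10 ^+ 4) /\ is_largest (isolated P) t].
Proof.
have [b [b_itv b_root]] := cubic_root R; have /andP[b1 b2] := b_itv.
have b0 : 0 < b by lra.
split; first exact: two_address_parameters_uncountable.
  exists b; split.
  - move=> x; split=> [/rootP|->]; last first.
      by apply/rootP; rewrite !hornerE; move: b_root; rewrite /cubic; lra.
    rewrite !hornerE => xr.
    (* The quadratic cofactor is (x + b/2)^2 + 3/4 b^2 - 2, which is positive since b > 23/13 -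
       1/13. *)
    have /eqP : (x - b) * (x ^+ 2 + x * b + b ^+ 2 - 2) = 0.
      have -> : (x - b) * (x ^+ 2 + x * b + b ^+ 2 - 2) =
        (x ^+ 3 - 2 * x - 2) + cubic b by rewrite /cubic; ring.
      by rewrite xr b_root addr0.
    rewrite mulf_eq0 subr_eq0 => /orP[/eqP//|/eqP].
    by have := sqr_ge0 (x + b / 2); nra.
  - rewrite /approx4 ltr_norml.
    have : 373 / 660 <= 1 / b.
      by rewrite -[leLHS]invf_div div1r lef_pV2 ?posrE; lra.
    have : 1 / b <= 13 / 23 by rewrite (ler_pdivrMr _ _ b0); lra.
    by move=> ? ?; apply/andP; split; lra.
  - rewrite div1r; split; first exact: limit_point_beta.
    by move=> x; exact: limit_point_le.
have [q [q1 q2 qP]] := largest_isolated b_itv b_root.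
exists q^-1; split => //.
have q0 : 0 < q by lra.
rewrite /approx4 ltr_norml.
have : 80 / 141 <= q^-1 by rewrite -[leLHS]invf_div lef_pV2 ?posrE; lra.
have : q^-1 <= 101 / 178 by rewrite -[leRHS]invf_div lef_pV2 ?posrE; lra.
by move=> ? ?; apply/andP; split; lra.
Qed.
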